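(* For all $m\in\mathbb{Z}$ and all positive integers $n$, the integers $M_{C1}(m,n)$ and $M_{C5}(m,n)$ are both nonnegative.
   Context: For $|q|<1$ (or formally in $q$), $(z;q)_{\infty}:=\prod_{j\geq0}(1-zq^{j})$ and $(a,b;q)_\infty:=(a;q)_\infty(b;q)_\infty$. The integers $M_{C1}(m,n)$ and $M_{C5}(m,n)$ ($m\in\mathbb{Z}$, $n\ge 1$) are defined by the two-variable generating functions $$\sum_{n=1}^{\infty}\sum_{m=-\infty}^{\infty}M_{C1}(m,n)z^{m}q^{n}=\sum_{n=1}^{\infty}\frac{q^{n}\left(q^{2n+1};q^{2}\right)_{\infty}\left(q^{n+1};q\right)_{\infty}}{\left(zq^{n},z^{-1}q^{n};q\right)_{\infty}},$$ $$\sum_{n=1}^{\infty}\sum_{m=-\infty}^{\infty}M_{C5}(m,n)z^{m}q^{n}=\sum_{n=1}^{\infty}\frac{q^{\frac{n^{2}+n}{2}}\left(q^{2n+1};q^{2}\right)_{\infty}\left(q^{n+1};q\right)_{\infty}}{\left(zq^{n},z^{-1}q^{n};q\right)_{\infty}},$$ where the right-hand sides are expanded as power series in $q$ whose coefficients are Laurent polynomials in $z$. *)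

(* Defs.v *)
From HB Require Import structures.
From mathcomp Require Import all_boot all_order all_algebra.
From mathcomp Require Import finmap monalg boolp classical_sets.

Set Implicit Arguments.
Unset Strict Implicit.
Unset Printing Implicit Defensive.

Import Order.TTheory GRing.Theory Num.Theory.
Local Open Scope ring_scope.

(* Laurent polynomials R[z, z^-1], as the group algebra of the additive group
   int: << c *g k >> is c z^k and f@_k is the coefficient of z^k in f. The
   ring structure of {malg R[K]} in monalg is not available here, as it requires
   K to have no invertible element but the unit. *)
Definition laurent (R : comNzRingType) := {malg R[int]}.

HB.instance Definition _ (R : comNzRingType) := GRing.Zmodule.copy (laurent R) {malg R[int]}.

Section LaurentRing.
Variable R : comNzRingType.
Implicit Types f g h : laurent R.

Definition laurent_one : laurent R := << (0 : int) >>.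

Definition laurent_mul f g : laurent R :=
  \sum_(i <- msupp f) \sum_(j <- msupp g) << f@_i * g@_j *g i + j >>.

Lemma laurent_mulw (d1 d2 : {fset int}) f g :
  (msupp f `<=` d1)%fset -> (msupp g `<=` d2)%fset ->
  laurent_mul f g = \sum_(i <- d1) \sum_(j <- d2) << f@_i * g@_j *g i + j >>.
Proof.
move=> le1 le2; rewrite /laurent_mul (big_fset_incl _ le1) /=.
  apply: eq_bigr => i _; apply/big_fset_incl => // j _ /mcoeff_outdom ->.
  by rewrite mulr0 monalgU0.
move=> i _ /mcoeff_outdom fi.
by rewrite big1 => // j _; rewrite fi mul0r monalgU0.
Qed.

Lemma laurent_mulUU (a b : R) (i j : int) :
  laurent_mul << a *g i >> << b *g j >> = << a * b *g i + j >>.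
Proof.
by rewrite (laurent_mulw msuppU_le msuppU_le) !big_seq_fset1 !mcoeffUU.
Qed.

Lemma laurent_mulC : commutative laurent_mul.
Proof.
move=> f g; rewrite /laurent_mul exchange_big /=.
by apply: eq_bigr => i _; apply: eq_bigr => j _; rewrite mulrC addrC.
Qed.

Lemma laurent_mulDl : left_distributive laurent_mul +%R.
Proof.
move=> f g h.
rewrite (laurent_mulw (msuppD_le f g) (fsubset_refl _)).
rewrite (laurent_mulw (fsubsetUl (msupp f) (msupp g)) (fsubset_refl (msupp h))).
rewrite (laurent_mulw (fsubsetUr (msupp f) (msupp g)) (fsubset_refl (msupp h))).
rewrite -big_split /=; apply: eq_bigr => i _.
rewrite -big_split /=; apply: eq_bigr => j _.
by rewrite mcoeffD mulrDl monalgUD.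
Qed.

Lemma laurent_mul0 g : laurent_mul 0 g = 0.
Proof. by apply: (addrI (laurent_mul 0 g)); rewrite -laurent_mulDl !addr0. Qed.

Lemma laurent_mul_suml (I : Type) (s : seq I) (F : I -> laurent R) g :
  laurent_mul (\sum_(i <- s) F i) g = \sum_(i <- s) laurent_mul (F i) g.
Proof.
exact: (big_morph (laurent_mul^~ g) (fun f h => laurent_mulDl f h g)
                  (laurent_mul0 g)).
Qed.

Lemma laurent_mul_sumr (I : Type) (s : seq I) (F : I -> laurent R) g :
  laurent_mul g (\sum_(i <- s) F i) = \sum_(i <- s) laurent_mul g (F i).
Proof.
rewrite laurent_mulC laurent_mul_suml.
by apply: eq_bigr => i _; rewrite laurent_mulC.
Qed.

Lemma laurent_mulEl f g :
  laurent_mul f g = \sum_(i <- msupp f) laurent_mul << f@_i *g i >> g.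
Proof. by rewrite [in LHS](monalgE f) laurent_mul_suml. Qed.

Lemma laurent_mulEr f g :
  laurent_mul f g = \sum_(j <- msupp g) laurent_mul f << g@_j *g j >>.
Proof. by rewrite [in LHS](monalgE g) laurent_mul_sumr. Qed.

Lemma laurent_mulA : associative laurent_mul.
Proof.
move=> f g h.
rewrite (laurent_mulEl f (laurent_mul g h)) (laurent_mulEl f g).
rewrite [RHS]laurent_mul_suml; apply: eq_bigr => i _.
rewrite (laurent_mulEl g h) (laurent_mulEr _ g).
rewrite [LHS]laurent_mul_sumr [RHS]laurent_mul_suml; apply: eq_bigr => j _.
rewrite (laurent_mulEr _ h) [RHS]laurent_mulEr.
rewrite [LHS]laurent_mul_sumr; apply: eq_bigr => k _.
by rewrite !laurent_mulUU mulrA addrA.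
Qed.

Lemma laurent_mul1 : left_id laurent_one laurent_mul.
Proof.
move=> f; rewrite [in LHS](monalgE f) laurent_mul_sumr [RHS]monalgE.
by apply: eq_bigr => i _; rewrite laurent_mulUU mul1r add0r.
Qed.

Lemma laurent_one_neq0 : laurent_one != 0.
Proof. by rewrite monalgU_eq0 oner_eq0. Qed.

HB.instance Definition _ := GRing.Zmodule_isComNzRing.Build (laurent R)
  laurent_mulA laurent_mulC laurent_mul1 laurent_mulDl laurent_one_neq0.

End LaurentRing.

(* Formal power series in q: fcoef f n is the coefficient of q^n in f. *)
Record fps (R : Type) := FPS { fcoef : nat -> R }.

Lemma fpsP (R : Type) (f g : fps R) :
  (forall n, fcoef f n = fcoef g n) -> f = g.
Proof. by case: f g => [f] [g] /= fg; congr FPS; apply/funext. Qed.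

HB.instance Definition _ (R : Type) := gen_eqMixin (fps R).
HB.instance Definition _ (R : Type) := gen_choiceMixin (fps R).

Section FpsRing.
Variable R : comNzRingType.
Implicit Types f g h : fps R.

Definition fps_add f g := FPS (fun n => fcoef f n + fcoef g n).
Definition fps_opp f := FPS (fun n => - fcoef f n).
Definition fpsC (c : R) : fps R := FPS (fun n => if n == 0%N then c else 0).
Definition fps_mul f g :=
  FPS (fun n => \sum_(i < n.+1) fcoef f i * fcoef g (n - i)%N).

Lemma fps_addA : associative fps_add.
Proof. by move=> f g h; apply: fpsP => n /=; rewrite addrA. Qed.
Lemma fps_addC : commutative fps_add.
Proof. by move=> f g; apply: fpsP => n /=; rewrite addrC. Qed.
Lemma fps_add0 : left_id (fpsC 0) fps_add.
Proof. by move=> f; apply: fpsP => n /=; rewrite if_same add0r. Qed.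
Lemma fps_addN : left_inverse (fpsC 0) fps_opp fps_add.
Proof. by move=> f; apply: fpsP => n /=; rewrite if_same addNr. Qed.

HB.instance Definition _ := GRing.isZmodule.Build (fps R)
  fps_addA fps_addC fps_add0 fps_addN.

Definition fps_trunc N f : {poly R} := \poly_(i < N) fcoef f i.

Lemma fps_mul_trunc N f g n : (n < N)%N ->
  fcoef (fps_mul f g) n = (fps_trunc N f * fps_trunc N g)`_n.
Proof.
move=> nN; rewrite coefM; apply: eq_bigr => -[i /= ile] _.
by rewrite !coef_poly !ifT // (leq_ltn_trans _ nN) ?leq_subr // -ltnS.
Qed.

Lemma fps_mulC : commutative fps_mul.
Proof.
by move=> f g; apply: fpsP => n; rewrite !(fps_mul_trunc _ _ (ltnSn n)) mulrC.
Qed.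

Lemma coef_trunc_mul N f g i : (i < N)%N ->
  (fps_trunc N (fps_mul f g))`_i = (fps_trunc N f * fps_trunc N g)`_i.
Proof. by move=> iN; rewrite coef_poly iN (fps_mul_trunc _ _ iN). Qed.

Lemma fps_mulA : associative fps_mul.
Proof.
move=> f g h; apply: fpsP => n; rewrite !(fps_mul_trunc _ _ (ltnSn n)).
transitivity (fps_trunc n.+1 f * fps_trunc n.+1 g * fps_trunc n.+1 h)`_n.
  rewrite -mulrA !coefM; apply: eq_bigr => i _.
  by rewrite coef_trunc_mul // ltnS leq_subr.
by rewrite !coefM; apply: eq_bigr => i _; rewrite coef_trunc_mul.
Qed.

Lemma fps_mul1 : left_id (fpsC 1) fps_mul.
Proof.
move=> f; apply: fpsP => n /=; rewrite big_ord_recl /= mul1r subn0 big1 ?addr0 //.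
by move=> i _; rewrite mul0r.
Qed.

Lemma fps_mulDl : left_distributive fps_mul +%R.
Proof.
move=> f g h; apply: fpsP => n /=; rewrite -big_split /=.
by apply: eq_bigr => i _; rewrite mulrDl.
Qed.

Lemma fps_one_neq0 : fpsC 1 != 0.
Proof.
by apply/eqP => /(congr1 (fun f => fcoef f 0)) /= /eqP; rewrite oner_eq0.
Qed.

HB.instance Definition _ := GRing.Zmodule_isComNzRing.Build (fps R)
  fps_mulA fps_mulC fps_mul1 fps_mulDl fps_one_neq0.

Definition fps_unit : pred (fps R) := fun f => `[< exists g, g * f = 1 >].
Definition fps_inv f : fps R := xget f [set g | g * f = 1]%classic.

Lemma fps_mulVr : {in fps_unit, left_inverse 1 fps_inv *%R}.
Proof. by move=> f /asboolP [g gf]; exact: (@xgetI _ f [set g | g * f = 1]%classic g gf). Qed.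

Lemma fps_unitP f g : g * f = 1 -> fps_unit f.
Proof. by move=> gf; rewrite /fps_unit; apply/asboolP; exists g. Qed.

Lemma fps_inv_out : {in [predC fps_unit], fps_inv =1 id}.
Proof.
move=> f; rewrite inE => /asboolPn nf; apply: xgetPN => g gf.
by apply: nf; exists g.
Qed.

HB.instance Definition _ := GRing.ComNzRing_hasMulInverse.Build (fps R)
  fps_mulVr fps_unitP fps_inv_out.

(* Limit in the q-adic topology: every coefficient is the eventual value of the
   corresponding coefficient of u N (and 0 if these do not stabilize). *)
Definition fps_lim (u : nat -> fps R) : fps R :=
  FPS (fun n => xget 0 [set c : R | exists N0, forall N, (N0 <= N)%N ->
                                      fcoef (u N) n = c]%classic).

Lemma fps_lim_coef (u : nat -> fps R) n N0 :
  (forall N, (N0 <= N)%N -> fcoef (u N) n = fcoef (u N0) n) ->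
  fcoef (fps_lim u) n = fcoef (u N0) n.
Proof.
move=> uN; apply: xget_unique => [|c [N1 uc]]; first by exists N0.
by rewrite -(uN (maxn N0 N1)) ?leq_maxl // uc // leq_maxr.
Qed.

Definition fpsX : fps R := FPS (fun n => (n == 1%N)%:R).

(* (a; b)_oo *)
Definition qpoch (a b : fps R) : fps R :=
  fps_lim (fun N => \prod_(j < N) (1 - a * b ^+ j)).

Lemma fcoefD f g n : fcoef (f + g) n = fcoef f n + fcoef g n.
Proof. by []. Qed.

Lemma fcoefB f g n : fcoef (f - g) n = fcoef f n - fcoef g n.
Proof. by []. Qed.

Lemma fcoef1 n : fcoef 1 n = (n == 0%N)%:R.
Proof. by case: n. Qed.

Lemma fcoefM f g n :
  fcoef (f * g) n = \sum_(i < n.+1) fcoef f i * fcoef g (n - i)%N.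
Proof. by []. Qed.

Lemma fcoefM0 f g : fcoef (f * g) 0 = fcoef f 0 * fcoef g 0.
Proof. by rewrite [LHS]big_ord_recl big_ord0 addr0. Qed.

Lemma fcoefM_lt k l f g : (forall i, (i < k)%N -> fcoef f i = 0) ->
  (forall i, (i < l)%N -> fcoef g i = 0) ->
  forall n, (n < k + l)%N -> fcoef (f * g) n = 0.
Proof.
move=> fk gl n nkl; apply: big1 => -[i /= ile] _.
have [ik|ki] := ltnP i k; first by rewrite fk // mul0r.
by rewrite gl ?mulr0 // ltn_subLR // (leq_trans nkl) // leq_add2r.
Qed.

Lemma fcoefX_lt f j : fcoef f 0 = 0 ->
  forall n, (n < j)%N -> fcoef (f ^+ j) n = 0.
Proof.
move=> f0; elim: j => // j IHj n nj; rewrite exprS.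
by apply: (@fcoefM_lt 1 j) => // -[].
Qed.

(* The infinite product converges as soon as a and b have no constant term. *)
Lemma qpoch_coef (a b : fps R) n N : fcoef a 0 = 0 -> fcoef b 0 = 0 ->
  (n <= N)%N ->
  fcoef (qpoch a b) n = fcoef (\prod_(j < N) (1 - a * b ^+ j)) n.
Proof.
move=> a0 b0 nN; apply: fps_lim_coef => M /subnKC <-.
elim: (M - N)%N => [|k IHk]; first by rewrite addn0.
have -> : \prod_(j < N + k.+1) (1 - a * b ^+ j) =
          \prod_(j < N + k) (1 - a * b ^+ j) * (1 - a * b ^+ (N + k)).
  by rewrite addnS big_ord_recr.
rewrite mulrBr mulr1 fcoefB -[RHS]subr0 -IHk; congr (_ - _).
apply: (@fcoefM_lt 0 (N + k).+1); [by []| |by rewrite add0n ltnS (leq_trans nN) ?leq_addr].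
move=> i iN; apply: (@fcoefM_lt 1 (N + k)) => //; first by case.
exact: fcoefX_lt.
Qed.

Lemma qpoch_coef0 (a b : fps R) : fcoef a 0 = 0 -> fcoef b 0 = 0 ->
  fcoef (qpoch a b) 0 = 1.
Proof. by move=> a0 b0; rewrite (@qpoch_coef _ _ 0 0) // big_ord0. Qed.

Lemma fps_unit_coef0 f : fcoef f 0 = 1 -> f \is a GRing.unit.
Proof.
move=> f0; pose h := 1 - f.
have h0 : fcoef h 0 = 0 by rewrite /h fcoefB fcoef1 f0 subrr.
have fE : f = 1 - h by rewrite /h subKr.
clearbody h.
apply/unitrPr; exists (FPS (fun n => fcoef (\sum_(i < n.+1) h ^+ i) n)).
apply: fpsP => n; set g := FPS _.
have -> : fcoef (f * g) n = fcoef (f * \sum_(i < n.+1) h ^+ i) n.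
  apply: eq_bigr => i _; congr (_ * _); rewrite /g /=.
  have := leq_subr i n; move: (n - i)%N => k kn.
  rewrite -(subnKC kn); elim: (n - k)%N => [|l IHl]; first by rewrite addn0.
  have -> : \sum_(i < (k + l.+1).+1) h ^+ i =
            \sum_(i < (k + l).+1) h ^+ i + h ^+ (k + l).+1.
    by rewrite addnS big_ord_recr.
  by rewrite fcoefD IHl (fcoefX_lt h0) ?addr0 // ltnS leq_addr.
have -> : f * \sum_(i < n.+1) h ^+ i = 1 - h ^+ n.+1.
  by rewrite fE -[RHS]opprB subrX1 -mulNr opprB.
by rewrite fcoefB (fcoefX_lt h0) // subr0.
Qed.
Lemma qpoch_unit (a b : fps R) : fcoef a 0 = 0 -> fcoef b 0 = 0 ->
  qpoch a b \is a GRing.unit.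
Proof. by move=> a0 b0; apply/fps_unit_coef0/qpoch_coef0. Qed.

(* A sum of terms of increasing order converges. *)
Lemma fps_lim_sum (F : nat -> fps R) n N :
  (forall k, (0 < k)%N -> forall i, (i < k)%N -> fcoef (F k) i = 0) ->
  (n <= N)%N ->
  fcoef (fps_lim (fun N => \sum_(1 <= k < N.+1) F k)) n =
  fcoef (\sum_(1 <= k < N.+1) F k) n.
Proof.
move=> F0 nN; apply: fps_lim_coef => M /subnKC <-.
elim: (M - N)%N => [|k IHk]; first by rewrite addn0.
have -> : \sum_(1 <= j < (N + k.+1).+1) F j =
          \sum_(1 <= j < (N + k).+1) F j + F (N + k).+1.
  by rewrite addnS big_nat_recr.
by rewrite fcoefD IHk F0 ?addr0 // ltnS (leq_trans nN) ?leq_addr.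
Qed.
End FpsRing.

Definition q : fps (laurent int) := fpsX _.
Definition zpow (m : int) : fps (laurent int) := fpsC (<< m >> : laurent int).
Definition z : fps (laurent int) := zpow 1.

Lemma zV : z^-1 = zpow (-1).
Proof.
have zz : zpow (-1) * z = 1.
  apply: fpsP => -[|n] /=.
    2: by rewrite big1 // => -[[|i] /= _] _; rewrite ?mulr0 ?mul0r.
  rewrite big_ord_recl big_ord0 addr0 /=.
  by rewrite [LHS]laurent_mulUU.
have zU : z \is a GRing.unit by exact: fps_unitP zz.
by apply: (mulIr zU); rewrite mulVr.
Qed.

Definition crank_factor (n : nat) : fps (laurent int) :=
  qpoch (q ^+ n.*2.+1) (q ^+ 2) * qpoch (q ^+ n.+1) q
    / (qpoch (z * q ^+ n) q * qpoch (z^-1 * q ^+ n) q).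

Lemma crank_den_unit n : (0 < n)%N ->
  qpoch (z * q ^+ n) q * qpoch (z^-1 * q ^+ n) q \is a GRing.unit.
Proof.
move=> n0; rewrite unitrM; apply/andP.
by split; apply: qpoch_unit; rewrite ?fcoefM0 ?(fcoefX_lt (f := q)) ?mulr0.
Qed.

Definition genC1 : fps (laurent int) :=
  fps_lim (fun N => \sum_(1 <= n < N.+1) q ^+ n * crank_factor n).

Definition genC5 : fps (laurent int) :=
  fps_lim (fun N =>
    \sum_(1 <= n < N.+1) q ^+ ((n ^ 2 + n) %/ 2)%N * crank_factor n).

Definition M_C1 (m : int) (n : nat) : int := (fcoef genC1 n)@_m.
Definition M_C5 (m : int) (n : nat) : int := (fcoef genC5 n)@_m.

Lemma q_coef_lt (w : nat -> nat) (G : nat -> fps (laurent int)) :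
  (forall k, (0 < k)%N -> (k <= w k)%N) ->
  forall k, (0 < k)%N -> forall i, (i < k)%N ->
  fcoef (q ^+ w k * G k) i = 0.
Proof.
move=> wk k k0 i ik; apply: (@fcoefM_lt _ (w k) 0) => //.
  exact: fcoefX_lt.
by rewrite addn0 (leq_trans ik) ?wk.
Qed.

Lemma M_C1E m n N : (n <= N)%N ->
  M_C1 m n =
  (fcoef (\sum_(1 <= k < N.+1) q ^+ k * crank_factor k) n : laurent int)@_m.
Proof.
move=> nN; congr mcoeff; apply: (fps_lim_sum (F := fun k => q ^+ k * crank_factor k)) => //.
exact: (q_coef_lt (w := id)).
Qed.

Lemma M_C5E m n N : (n <= N)%N ->
  M_C5 m n =
  (fcoef (\sum_(1 <= k < N.+1) q ^+ ((k ^ 2 + k) %/ 2)%N * crank_factor k) n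
     : laurent int)@_m.
Proof.
move=> nN; congr mcoeff; apply: (fps_lim_sum
  (F := fun k => q ^+ ((k ^ 2 + k) %/ 2)%N * crank_factor k)) => //.
apply: (q_coef_lt (w := fun k => (k ^ 2 + k) %/ 2)%N) => k k0.
by rewrite leq_divRL // muln2 -addnn leq_add2r -{1}[k]expn1 leq_pexp2l.
Qed.

(* Main.v *)
Require Import Defs.
From mathcomp Require Import all_boot all_order all_algebra.
From mathcomp Require Import finmap monalg ring zify.

Set Implicit Arguments.
Unset Strict Implicit.
Unset Printing Implicit Defensive.

Import Order.TTheory GRing.Theory Num.Theory.
Local Open Scope ring_scope.

(** The summands of the two generating functions have numerators that their
    denominators do not absorb, so positivity is not visible term by term: it
    appears once the sum over [n] has been carried out.

    Write [(q)_k], [(q;q^2)_k] for [qfact q k], [odd_qfact q k] and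
    [(q^2;q^2)_oo] for [qpoch (q^2) (q^2)].  Up to a factor that does not depend on [n], the [n]-th
    summand is [q^(w n) / ((q;q^2)_n (q)_n)] divided by the product over
    [i >= n] of [(1 - z q^i)(1 - q^i / z)], with [w n = n] for C1 and
    [w n = n (n + 1) / 2] for C5.  Decompose this into partial fractions in
    [z + 1/z] ([partial_fractions]; the product is first truncated at [i <= M])
    and sum over [n] the coefficients of [1 / ((1 - z q^j)(1 - q^j / z))]
    ([finite_bailey]).  Including the missing term [n = 0], the sum over [n] is
    the terminating series [inversion_sum], which has a closed form: it is 0
    for odd [j], and for [j = 2 k] it is [(-1)^k q^(k (3 k + 1))] for C1
    ([inversion_sum_id]) and [(-1)^k q^(k (k + 1))] for C5
    ([inversion_sum_triangular]).  This follows from a two-step recurrence in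
    [j], itself proved by telescoping.  Since
    [(1 - x^2) / ((1 - z x)(1 - x / z))] is the sum of [x^|m| z^m] over all
    integers [m] ([poisson_expansion]), the coefficient of [z^m] in the
    generating function becomes, with [a = |m|],
    [1 / (q^2;q^2)_oo] times the sum over [j >= 1] of
    [q^(j a) (inversion_sum j - (-1)^j q^(j (j + 1) / 2)) / (1 - q^j)]
    ([generating_eqmod]).

    That sum is regrouped: the term of odd index [j] ([odd_term]) is put with
    the term of index [2 j] ([even_term]).  Over the common denominator
    [1 - q^(2 j)] the numerator of such a pair consists of two positive and two
    negative powers of [q^j]; matching their exponents by parity
    ([odd_blockE]) shows that the quotient is a polynomial or a series with
    nonnegative coefficients.  The terms of index [2 n] with [n] even are
    nonnegative for C5.  For C1 such a term is minus a sum of [n / 2] monomials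
    ([even_blockE]), but these are dominated by as many monomials of the pair
    of index [n - 1], of smaller degree and of the same parity, once divided by
    the factor [1 - q^2] of [(q^2;q^2)_oo] ([nneg_block_C1]).

    Everything is done with finite sums and products, modulo a power of [q]
    larger than the degree of the coefficient under consideration. *)

(** * Terminating sums *)

Ltac ring_exp :=
  rewrite -?addnn ?add0n ?addn0 ?(binS _ 1, bin1, exprS, exprD, expr0); ring.

Section FiniteIdentities.
Variables (R : comUnitRingType) (x : R).

Definition qfact k := \prod_(i < k) (1 - x ^+ i.+1).

Definition odd_qfact k := \prod_(i < k) (1 - x ^+ i.*2.+1).

(** Up to a sign and a power of [x], this is the product of the two q-shifted
    factorials of [x^-N] and [x^N]; this form needs no inverse of [x].  It
    vanishes for [n > N] because the truncated [N - i] is then 0 for [i = N]. *)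
Definition symprod N n :=
  \prod_(i < n) ((1 - x ^+ (N - i)) * (1 - x ^+ (N + i))).

(** The [beta] side of the Bailey pair behind C1, relative to [a = 1]. *)
Definition beta n := (odd_qfact n * qfact n)^-1.

(** The summand of Bailey inversion, which recovers the [alpha] side of a Bailey
    pair from [x^(w n - n) * beta n], normalised so that no denominator other
    than [beta] remains. *)
Definition inversion_term (w : nat -> nat) N n :=
  (-1) ^+ (N + n) * x ^+ ('C((N - n).+1, 2) + w n) * symprod N n * beta n.

Definition inversion_sum w N := \sum_(n < N.+1) inversion_term w N n.

Hypothesis xU : forall k, (0 < k)%N -> 1 - x ^+ k \is a GRing.unit.

Lemma qfact0 : qfact 0 = 1.
Proof. by rewrite /qfact big_ord0. Qed.

Lemma qfactS k : qfact k.+1 = qfact k * (1 - x ^+ k.+1).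
Proof. by rewrite /qfact big_ord_recr. Qed.

Lemma odd_qfactS k : odd_qfact k.+1 = odd_qfact k * (1 - x ^+ k.*2.+1).
Proof. by rewrite /odd_qfact big_ord_recr. Qed.

Lemma qfact_unit k : qfact k \is a GRing.unit.
Proof.
elim: k => [|k IHk]; first by rewrite /qfact big_ord0 unitr1.
by rewrite qfactS unitrM IHk xU.
Qed.

Lemma odd_qfact_unit k : odd_qfact k \is a GRing.unit.
Proof.
elim: k => [|k IHk]; first by rewrite /odd_qfact big_ord0 unitr1.
by rewrite odd_qfactS unitrM IHk xU.
Qed.

Lemma betaS n : beta n = (1 - x ^+ n.+1) * (1 - x ^+ n.*2.+1) * beta n.+1.
Proof.
have bU k : odd_qfact k * qfact k \is a GRing.unit.
  by rewrite unitrM odd_qfact_unit qfact_unit.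
apply: (mulrI (bU n.+1)); rewrite mulrCA [X in _ = _ * X]divrr // mulr1.
rewrite qfactS odd_qfactS /beta.
transitivity ((odd_qfact n * qfact n) / (odd_qfact n * qfact n) *
  ((1 - x ^+ n.+1) * (1 - x ^+ n.*2.+1))); first by ring.
by rewrite divrr // mul1r.
Qed.

Lemma symprod0 N : symprod N 0 = 1.
Proof. by rewrite /symprod big_ord0. Qed.

Lemma symprodS N n :
  symprod N n.+1 = symprod N n * ((1 - x ^+ (N - n)) * (1 - x ^+ (N + n))).
Proof. by rewrite /symprod big_ord_recr. Qed.

Lemma symprod_eq0 N n : (N < n)%N -> symprod N n = 0.
Proof.
move=> Nn; rewrite /symprod (bigD1 (Ordinal Nn)) //=.
by rewrite subnn expr0 subrr !mul0r.
Qed.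

(** The two shifts express the summands of index [N + 1] and [N - 1] by those of
    index [N], which is what makes the telescoping below a polynomial
    identity. *)
Lemma symprod_shift_up N n :
  (1 - x ^+ N) * symprod N.+1 n.+1 =
  (1 - x ^+ N.+1) * (1 - x ^+ (N + n)) * (1 - x ^+ (N + n.+1)) * symprod N n.
Proof.
elim: n => [|n IHn].
  by rewrite symprodS /symprod !big_ord0 subn0 !addn0 addn1; ring.
rewrite symprodS mulrA IHn (symprodS N n) subSS addSnnS.
by rewrite -!addSnnS; ring.
Qed.

Lemma symprod_shift_down N n :
  (1 - x ^+ N.+1) * symprod N n.+1 =
  (1 - x ^+ N) * (1 - x ^+ (N.+1 - n)) * (1 - x ^+ (N - n)) * symprod N.+1 n.
Proof.
elim: n => [|n IHn].
  by rewrite symprodS /symprod !big_ord0 !subn0 addn0; ring.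
rewrite symprodS mulrA IHn (symprodS N.+1 n) subSS addSnnS; ring.
Qed.

Lemma symprod_qfact N n : (n <= N.+1)%N ->
  symprod N.+1 n * qfact (N.+1 - n) * qfact N = qfact N.+1 * qfact (N + n).
Proof.
elim: n => [|n IHn] nN; first by rewrite /symprod big_ord0 mul1r subn0 addn0.
rewrite addnS (qfactS (N + n)) mulrA -IHn; last exact: ltnW.
by rewrite symprodS subSS (@subSn n N nN) (qfactS (N - n)) addSn; ring.
Qed.

Lemma symprod_diag n :
  symprod n.+1 n.+1 * (1 + x ^+ n.+1) = qfact (n.+1 + n.+1).
Proof.
have := symprod_qfact (leqnn n.+1); rewrite subnn qfact0 mulr1 => E.
apply: (mulIr (qfact_unit n)).
rewrite mulrAC E addSn !qfactS -addSn exprD; ring.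
Qed.

Lemma sign_up N p d : (0 < N)%N -> N = (p + d)%N ->
  (-1) ^+ (N.+1 + p.+1) = (-1) ^+ d :> R.
Proof.
move=> N0 NE; rewrite -signr_odd -[RHS]signr_odd NE !oddD /= oddD.
by case: (odd p); case: (odd d).
Qed.

Lemma sign_down N p d : (0 < N)%N -> N = (p + d)%N ->
  (-1) ^+ (N.-1 + p.+1) = (-1) ^+ d :> R.
Proof.
move=> N0 NE; rewrite addnS -addSn prednK //.
rewrite -signr_odd -[RHS]signr_odd NE !oddD.
by case: (odd p); case: (odd d).
Qed.

Lemma invr_factor (a b : R) : a \is a GRing.unit -> b \is a GRing.unit ->
  a^-1 = b * (a * b)^-1.
Proof. by move=> aU bU; rewrite invrM // mulVKr. Qed.

(** Creative telescoping.  The sum of [inversion_term w N.+1 n] and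
    [x^c * inversion_term w N.-1 n] over [n <= p] is a single term; [s] gives
    the exponent of the certificate and [d = N + 1 - p].  The hypotheses [base]
    and [step] are what is left after cancelling the common factors. *)
Section Telescoping.
Variables (w s : nat -> nat) (c N : nat).
Hypothesis N0 : (0 < N)%N.
Hypothesis base : x ^+ ('C(N.+2, 2) + w 0) + x ^+ (c + 'C(N, 2) + w 0) =
  (1 + x ^+ N) * x ^+ ('C(N.+1, 2) + s 0).
Hypothesis step : forall p d, (p + d = N)%N ->
  x ^+ ('C(d.+1, 2) + w p.+1) * (1 - x ^+ N.+1) * (1 - x ^+ (N + p)) *
    (1 - x ^+ (N + p.+1)) +
  x ^+ (c + 'C(d.-1, 2) + w p.+1) * (1 - x ^+ N.-1) * (1 - x ^+ d) *
    (1 - x ^+ d.-1) =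
  (1 - x ^+ N) * (1 + x ^+ N) *
  (x ^+ ('C(d.+1, 2) + s p) * (1 - x ^+ p.+1) * (1 - x ^+ p.*2.+1) +
   x ^+ ('C(d, 2) + s p.+1) * (1 - x ^+ d) * (1 - x ^+ (N + p))).

Lemma inversion_term_telescope p d : (p + d = N.+1)%N ->
  \sum_(n < p.+1) (inversion_term w N.+1 n + x ^+ c * inversion_term w N.-1 n) =
  (-1) ^+ d * (1 + x ^+ N) * x ^+ ('C(d, 2) + s p) * symprod N p * beta p.
Proof.
elim: p d => [|p IHp] d pd.
  rewrite big_ord1 /inversion_term !symprod0 !subn0 !addn0 -pd add0n.
  rewrite !mulr1 -!mulrA.
  have -> : (-1) ^+ N.-1 = (-1) ^+ N.+1 :> R.
    by rewrite -(prednK N0) /= -addn2 exprD sqrrN expr1n mulr1.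
  move: pd; rewrite add0n prednK // => ->.
  transitivity ((-1) ^+ N.+1 * beta 0 *
    (x ^+ ('C(N.+2, 2) + w 0) + x ^+ (c + 'C(N, 2) + w 0))).
    by rewrite -(addnA c) (exprD x c); ring.
  by rewrite base; ring.
rewrite big_ord_recr /= (IHp d.+1); last by rewrite -pd addSnnS.
have {pd}NE : N = (p + d)%N by move: pd; rewrite addSn => -[].
apply: (mulrI (xU N0)); rewrite betaS /inversion_term.
rewrite (sign_up N0 NE) (sign_down N0 NE).
have U := symprod_shift_up N p.
have := symprod_shift_down N.-1 p; rewrite prednK // => V.
rewrite (symprodS N p) (_ : N - p = d)%N; last by rewrite NE addKn.
have -> : (N.+1 - p.+1 = d)%N by rewrite subSS NE addKn.
(* For d <= 1 the subtraction is truncated, but both binomials vanish. *)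
have -> : 'C((N.-1 - p.+1).+1, 2) = 'C(d.-1, 2).
  rewrite NE; case: (d) => [|[|k]].
  - by rewrite (_ : _ - _ = 0)%N //; lia.
  - by rewrite (_ : _ - _ = 0)%N //; lia.
  by congr 'C(_, 2); lia.
set s1 := symprod N.+1 p.+1 in U *; set s2 := symprod N.-1 p.+1 in V *.
set sp := symprod N p in U V *.
transitivity ((-1) ^+ d * beta p.+1 *
  (x ^+ ('C(d.+1, 2) + w p.+1) * ((1 - x ^+ N) * s1) +
   x ^+ (c + 'C(d.-1, 2) + w p.+1) * ((1 - x ^+ N) * s2) -
   (1 - x ^+ N) * (1 + x ^+ N) * x ^+ ('C(d.+1, 2) + s p) * sp *
          ((1 - x ^+ p.+1) * (1 - x ^+ p.*2.+1)))).
  by rewrite -(addnA c) (exprD x c) !(exprS (-1)); ring.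
rewrite U V (_ : N - p = d)%N; last by rewrite NE addKn.
rewrite (_ : N.-1 - p = d.-1)%N; last by rewrite NE; lia.
transitivity ((-1) ^+ d * beta p.+1 * sp *
  ((x ^+ ('C(d.+1, 2) + w p.+1) * (1 - x ^+ N.+1) * (1 - x ^+ (N + p)) *
    (1 - x ^+ (N + p.+1)) +
  x ^+ (c + 'C(d.-1, 2) + w p.+1) * (1 - x ^+ N.-1) * (1 - x ^+ d) *
    (1 - x ^+ d.-1)) -
   (1 - x ^+ N) * (1 + x ^+ N) * x ^+ ('C(d.+1, 2) + s p) *
          ((1 - x ^+ p.+1) * (1 - x ^+ p.*2.+1)))); first by ring.
by rewrite (step (esym NE)); ring.
Qed.

(** At [p = N + 1] the telescoped term contains [symprod N N.+1 = 0]. *)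
Lemma inversion_sum_rec :
  inversion_sum w N.+1 = - x ^+ c * inversion_sum w N.-1.
Proof.
apply/eqP; rewrite mulNr -addr_eq0; apply/eqP.
have := inversion_term_telescope (addn0 N.+1).
rewrite symprod_eq0 // mulr0 mul0r => <-.
rewrite big_split /= -mulr_sumr; congr (_ + _ * _).
rewrite /inversion_sum prednK // !(big_ord_recr N.+1) !(big_ord_recr N) /=.
rewrite /inversion_term.
by rewrite !(@symprod_eq0 N.-1) ?mulr0 ?mul0r ?addr0 // prednK.
Qed.

End Telescoping.

Lemma inversion_sum0 w : w 0%N = 0%N -> inversion_sum w 0 = 1.
Proof.
move=> w0; rewrite /inversion_sum big_ord1 /inversion_term symprod0 w0.
rewrite /beta /qfact /odd_qfact.
by rewrite !big_ord0 !mulr1 invr1 mulr1.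
Qed.

Lemma inversion_sum1 w : w 0%N = 0%N -> w 1%N = 1%N -> inversion_sum w 1 = 0.
Proof.
move=> w0 w1; rewrite /inversion_sum !big_ord_recl big_ord0 /inversion_term /=.
rewrite /bump /= w0 w1.
rewrite -[(1 + 0)%N]/1%N symprod0 (symprodS 1 0) symprod0.
rewrite (betaS 0) /=; ring.
Qed.

(** Case C1: the recurrence exponent is [c = 3 N + 1] and the certificate
    exponent is constant in [p]. *)
Lemma inversion_sum_id k :
  inversion_sum id k.*2 = (-1) ^+ k * x ^+ (k * (3 * k + 1)) /\
  inversion_sum id k.*2.+1 = 0.
Proof.
have rec N : (0 < N)%N ->
    inversion_sum id N.+1 = - x ^+ (N + N + N).+1 * inversion_sum id N.-1.
  move=> N0; apply: (@inversion_sum_rec _ (fun=> N.+1)) => //.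
    by case: N N0 => // N _; ring_exp.
  by move=> p [|[|d]] <-; rewrite ?addnS /=; ring_exp.
elim: k => [|k [IH0 IH1]].
  by rewrite inversion_sum0 ?inversion_sum1 ?mul0n ?mulr1.
rewrite doubleS (rec k.*2.+1) // (rec k.*2.+2) //= IH0 IH1 mulr0; split=> //.
rewrite (exprS (-1)) mulN1r !mulNr mulrCA -exprD; congr (- (_ * x ^+ _)); lia.
Qed.

(** Case C5, which is case C1 under [x -> 1/x]. *)
Lemma inversion_sum_triangular k :
  inversion_sum (fun n => 'C(n.+1, 2)) k.*2 = (-1) ^+ k * x ^+ (k * (k + 1)) /\
  inversion_sum (fun n => 'C(n.+1, 2)) k.*2.+1 = 0.
Proof.
have rec N : (0 < N)%N -> inversion_sum (fun n => 'C(n.+1, 2)) N.+1 =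
    - x ^+ N.+1 * inversion_sum (fun n => 'C(n.+1, 2)) N.-1.
  move=> N0; apply: (@inversion_sum_rec _ (fun p => 'C(p.+2, 2))) => //.
    by case: N N0 => // N _; ring_exp.
  by move=> p [|[|d]] <-; rewrite ?addnS /=; ring_exp.
elim: k => [|k [IH0 IH1]].
  by rewrite inversion_sum0 ?inversion_sum1 ?mul0n ?mulr1.
rewrite doubleS (rec k.*2.+1) // (rec k.*2.+2) //= IH0 IH1 mulr0; split=> //.
rewrite (exprS (-1)) mulN1r !mulNr mulrCA -exprD; congr (- (_ * x ^+ _)); lia.
Qed.

(** * Partial fractions *)

(** The hypothesis [DE] holds for [D j = (1 - y x^j)(1 - x^j / y)], and is all
    that the decomposition uses: [D (n + d)] and [D n] are affine in
    [y + 1/y], so a combination of them is constant. *)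
Section PartialFractions.
Variable D : nat -> R.
Hypothesis DU : forall n, D n.+1 \is a GRing.unit.
Hypothesis DE : forall n d,
  D (n + d) - x ^+ d * D n = (1 - x ^+ d) * (1 - x ^+ (n + n + d)).

Definition pfrac_coef n M j :=
  (-1) ^+ (j + n) * x ^+ 'C((j - n).+1, 2) * symprod j n *
  (1 + x ^+ j) / qfact (M - j) / qfact (M + j).

Lemma qfactV k : (qfact k)^-1 = (1 - x ^+ k.+1) / qfact k.+1.
Proof. by rewrite qfactS -invr_factor ?qfact_unit ?xU. Qed.

(** The identity that [DE] imposes on the coefficients: dividing [DE] by the
    product of the [D i] for [n <= i <= M], with [M = n + d + 1], expresses its
    inverse by those for the ranges [n..M-1] and [n+1..M]. *)
Lemma pfrac_coef_rec n d j : (j < n + d.+1)%N ->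
  (1 - x ^+ d.+1) * (1 - x ^+ (n + n + d.+1)) * pfrac_coef n (n + d.+1) j =
  pfrac_coef n (n + d) j - x ^+ d.+1 * pfrac_coef n.+1 (n.+1 + d) j.
Proof.
have [jn _|nj] := ltnP j n.
  have jn1 : (j < n.+1)%N by exact: ltnW.
  rewrite /pfrac_coef (symprod_eq0 jn) (symprod_eq0 jn1).
  by rewrite !(mulr0, mul0r) subr0.
rewrite addnS ltnS -(subnKC nj); move: (j - n)%N => e.
rewrite leq_add2l => /subnKC <-; move: (d - e)%N => g.
rewrite /pfrac_coef symprodS subSn; last by lia.
have -> : (n + (e + g) - (n + e) = g)%N by lia.
have -> : (n + e - n = e)%N by lia.
rewrite (qfactV g) addSn (qfactV (n + (e + g) + (n + e))).
(* For e = 0 the subtraction is truncated, but the factor 1 - x ^+ e is 0. *)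
have : x ^+ e * x ^+ 'C((n + e - n.+1).+1, 2) * (1 - x ^+ e) =
   x ^+ 'C(e.+1, 2) * (1 - x ^+ e).
  case: (e) => [|k]; first by rewrite subrr !mulr0.
  by rewrite addnS subSS addKn; ring_exp.
set t := x ^+ 'C((n + e - n.+1).+1, 2); set u := 'C(e.+1, 2) => H.
transitivity ((-1) ^+ (n + e + n) * symprod (n + e) n * (1 + x ^+ (n + e)) /
   qfact g.+1 / qfact (n + (e + g) + (n + e)).+1 *
   (1 - x ^+ (e + g).+1) * (1 - x ^+ (n + n + (e + g).+1)) * x ^+ u).
  by ring.
transitivity ((-1) ^+ (n + e + n) * symprod (n + e) n * (1 + x ^+ (n + e)) /
   qfact g.+1 / qfact (n + (e + g) + (n + e)).+1 *
   ((1 - x ^+ g.+1) * (1 - x ^+ (n + (e + g) + (n + e)).+1) * x ^+ u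
    + x ^+ g.+1 * (x ^+ e * t * (1 - x ^+ e)) * (1 - x ^+ (n + e + n)))).
  by rewrite H !(exprS, exprD); ring.
have -> : x ^+ (e + g).+1 = x ^+ e * x ^+ g.+1 by rewrite -addnS exprD.
have -> : (-1) ^+ (n + e + n.+1) = - (-1) ^+ (n + e + n) :> R.
  by rewrite addnS exprS mulN1r.
ring.
Qed.

(** The same relation for [j = M], where the range [n..M-1] has no pole. *)
Lemma pfrac_coef_diag n d :
  (1 - x ^+ d.+1) * (1 - x ^+ (n + n + d.+1)) *
    pfrac_coef n (n + d.+1) (n + d.+1) =
  - x ^+ d.+1 * pfrac_coef n.+1 (n.+1 + d) (n + d.+1).
Proof.
rewrite /pfrac_coef symprodS addSnnS subnn.
have -> : (n + d.+1 - n = d.+1)%N by lia.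
have -> : (n + d.+1 - n.+1 = d)%N by lia.
have -> : (-1) ^+ (n + d.+1 + n.+1) = - (-1) ^+ (n + d.+1 + n) :> R.
  by rewrite (addnS (n + d.+1)) exprS mulN1r.
rewrite (binS _ 1) bin1 (exprD x 'C(d.+1, 2)).
rewrite (_ : n + n + d.+1 = n + d.+1 + n)%N; last by lia.
ring.
Qed.

Lemma partial_fractions n d : (0 < n)%N ->
  (\prod_(n <= i < (n + d).+1) D i)^-1 =
  \sum_(1 <= j < (n + d).+1) pfrac_coef n (n + d) j / D j.
Proof.
have DU' k : (0 < k)%N -> D k \is a GRing.unit by case: k => // k _; exact: DU.
elim: d n => [|d IHd] n n0.
  rewrite addn0 big_nat1 big_nat_recr //= big_nat.
  rewrite big1 => [|j /andP[_ jn]]; last first.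
    by rewrite /pfrac_coef symprod_eq0 // !(mulr0, mul0r).
  case: n n0 => // n _; rewrite add0r /pfrac_coef subnn bin_small //.
  rewrite addnn -signr_odd.
  rewrite odd_double !expr0 !mul1r symprod_diag -addnn qfact0 divr1.
  by rewrite divrr ?qfact_unit // mul1r.
have cU : (1 - x ^+ d.+1) * (1 - x ^+ (n + n + d.+1)) \is a GRing.unit.
  by rewrite unitrM !xU // addnS.
apply: (mulrI cU).
transitivity (\sum_(1 <= j < (n + d).+1) pfrac_coef n (n + d) j / D j -
  x ^+ d.+1 *
    \sum_(1 <= j < (n.+1 + d).+1) pfrac_coef n.+1 (n.+1 + d) j / D j);
  last first.
  have CD := pfrac_coef_diag n d; have CR := @pfrac_coef_rec n d.
  set cc := (1 - x ^+ d.+1) * _ in CD CR *; clearbody cc.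
  have NE : (n + d).+1 = (n + d.+1)%N by rewrite addnS.
  rewrite addSnnS NE ![\sum_(1 <= j < (n + d.+1).+1) _]big_nat_recr -?NE //= NE.
  rewrite !mulrDr opprD addrA [X in _ = _ + X]mulrA CD !mulNr addSnnS.
  rewrite -[X in _ = _ - X]mulrA.
  congr (_ - _).
  rewrite !mulr_sumr -sumrB big_nat [RHS]big_nat.
  apply: eq_bigr => j /andP[_ jM].
  by rewrite [RHS]mulrA CR // addSnnS; ring.
rewrite -!IHd // -DE.
have PU a b : (0 < a)%N -> \prod_(a <= i < b) D i \is a GRing.unit.
  move=> a0; rewrite big_nat rpred_prod // => i /andP[ai _].
  exact/DU'/(leq_trans a0).
rewrite (@invr_factor (\prod_(n <= i < (n + d).+1) D i) (D (n + d.+1)));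
  rewrite ?PU ?DU' // ?addnS //.
rewrite (@invr_factor (\prod_(n.+1 <= i < _) D i) (D n)) ?PU ?DU' //.
rewrite -big_nat_recr; last by lia.
rewrite -addSn [X in _ - _ * (_ * X^-1)]mulrC -big_ltn; last by lia.
rewrite addSn -addnS; ring.
Qed.

Lemma inversion_sum_widen w j M : (j <= M)%N ->
  \sum_(1 <= n < M.+1) inversion_term w j n =
  inversion_sum w j - inversion_term w j 0.
Proof.
move=> jM; rewrite /inversion_sum -(big_mkord xpredT (inversion_term w j)).
rewrite [in RHS]big_ltn // addrAC subrr add0r (big_cat_nat _ (n := j.+1)) //=.
rewrite [X in _ + X]big_nat [X in _ + X]big1 ?addr0 //.
by move=> n /andP[jn _]; rewrite /inversion_term symprod_eq0 // mulr0 mul0r.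
Qed.

(** A finite form of Bailey's lemma: exchanging the two sums turns a sum over
    denominators into a sum over poles.  The coefficient of the pole [j] lacks
    the term [n = 0] of [inversion_sum], because the left-hand side starts at
    [n = 1]. *)
Lemma finite_bailey w M :
  \sum_(1 <= n < M.+1) x ^+ w n * beta n / \prod_(n <= i < M.+1) D i =
  \sum_(1 <= j < M.+1) (inversion_sum w j - inversion_term w j 0) *
     (1 + x ^+ j) / D j / qfact (M - j) / qfact (M + j).
Proof.
transitivity (\sum_(1 <= n < M.+1) \sum_(1 <= j < M.+1)
   inversion_term w j n * ((1 + x ^+ j) / D j / qfact (M - j) / qfact (M + j))).
  rewrite big_nat [RHS]big_nat; apply: eq_bigr => n /andP[n0 nM].
  have := partial_fractions (M - n) n0; rewrite subnKC // => ->.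
  rewrite mulr_sumr.
  apply: eq_bigr => j _; rewrite /pfrac_coef /inversion_term (exprD x); ring.
rewrite exchange_big_nat /= big_nat [RHS]big_nat.
apply: eq_bigr => j /andP[j0 jM].
rewrite -mulr_suml inversion_sum_widen //; ring.
Qed.
End PartialFractions.
End FiniteIdentities.

(** * Congruences modulo a power of q *)

Section Adic.
Variable S : comNzRingType.
Implicit Types f g h x : fps S.

Definition vanish K f := forall i, (i < K)%N -> fcoef f i = 0.

Definition eqmod K f g := vanish K (f - g).

Lemma vanishM j k f g : vanish j f -> vanish k g -> vanish (j + k) (f * g).
Proof. by move=> fj gk i ijk; apply: (fcoefM_lt fj gk). Qed.

Lemma vanishD K f g : vanish K f -> vanish K g -> vanish K (f + g).
Proof. by move=> fK gK i iK; rewrite fcoefD fK ?gK ?addr0. Qed.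

Lemma vanishN K f : vanish K f -> vanish K (- f).
Proof. by move=> fK i iK; rewrite -[LHS]/(- fcoef f i) fK ?oppr0. Qed.

Lemma vanishMl K f g : vanish K g -> vanish K (f * g).
Proof. by move=> gK; rewrite -[K]add0n; apply: vanishM. Qed.

Lemma vanishMr K f g : vanish K f -> vanish K (f * g).
Proof. by rewrite mulrC; apply: vanishMl. Qed.

Lemma vanish_le K L f : (L <= K)%N -> vanish K f -> vanish L f.
Proof. by move=> LK fK i iL; apply/fK/(leq_trans iL). Qed.

Lemma vanish_exp x (x0 : fcoef x 0 = 0) K k : (K <= k)%N -> vanish K (x ^+ k).
Proof. by move=> Kk; apply: (vanish_le Kk); apply: fcoefX_lt. Qed.

Lemma one_sub_unit x (x0 : fcoef x 0 = 0) k :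
  (0 < k)%N -> 1 - x ^+ k \is a GRing.unit.
Proof.
move=> k0; apply: fps_unit_coef0; rewrite fcoefB fcoef1 eqxx.
by rewrite (fcoefX_lt x0) // subr0.
Qed.

Lemma eqmod_refl K f : eqmod K f f.
Proof. by move=> i _; rewrite fcoefB subrr. Qed.

Lemma eqmod_coef K f g i : eqmod K f g -> (i < K)%N -> fcoef f i = fcoef g i.
Proof. by move=> fg iK; apply/eqP; rewrite -subr_eq0 -fcoefB fg. Qed.

Lemma eqmodM K f f' g g' : eqmod K f f' -> eqmod K g g' ->
  eqmod K (f * g) (f' * g').
Proof.
move=> ff gg; rewrite /eqmod.
have -> : f * g - f' * g' = (f - f') * g + f' * (g - g') by ring.
by apply: vanishD; [apply: vanishMr | apply: vanishMl].
Qed.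

Lemma eqmodV K f g : f \is a GRing.unit -> g \is a GRing.unit ->
  eqmod K f g -> eqmod K f^-1 g^-1.
Proof.
move=> fU gU fg; rewrite /eqmod.
have -> : f^-1 - g^-1 = (f - g) * (- (f^-1 * g^-1)).
  transitivity (f^-1 * (g / g) - (f / f) * g^-1); last by ring.
  by rewrite !divrr // mulr1 mul1r.
exact: vanishMr.
Qed.

(** A factor of order [j] gains [j] orders of precision. *)
Lemma eqmod_shift j K f g h : vanish j h -> eqmod K f g ->
  eqmod (j + K) (h * f) (h * g).
Proof. by move=> hj fg; rewrite /eqmod -mulrBr; apply: vanishM. Qed.

Lemma eqmod_sum K (I : Type) (r : seq I) (P : pred I) (F G : I -> fps S) :
  (forall i, P i -> eqmod K (F i) (G i)) ->
  eqmod K (\sum_(i <- r | P i) F i) (\sum_(i <- r | P i) G i).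
Proof.
move=> FG; apply: (big_ind2 (eqmod K)) => //; first exact: eqmod_refl.
by move=> f f' g g' ff gg; rewrite /eqmod opprD addrACA; apply: vanishD.
Qed.

Lemma eqmod_prod1 K n (F : nat -> fps S) :
  (forall i, eqmod K (F i) 1) -> eqmod K (\prod_(i < n) F i) 1.
Proof.
move=> F1; apply: (big_ind (fun f => eqmod K f 1)) => //.
  exact: eqmod_refl.
by move=> f g f1 g1; rewrite -[1]mulr1; apply: eqmodM.
Qed.

Lemma qpoch_split (a b : fps S) n : fcoef a 0 = 0 -> fcoef b 0 = 0 ->
  qpoch a b = (\prod_(j < n) (1 - a * b ^+ j)) * qpoch (a * b ^+ n) b.
Proof.
move=> a0 b0; apply: fpsP => k.
have ab0 : fcoef (a * b ^+ n) 0 = 0 by rewrite fcoefM0 a0 mul0r.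
have H c N : fcoef c 0 = 0 -> (k < N)%N ->
    eqmod k.+1 (qpoch c b) (\prod_(j < N) (1 - c * b ^+ j)).
  by move=> c0 kN i ik; rewrite fcoefB (@qpoch_coef _ _ _ _ N) ?subrr //; lia.
have nk : (k < n + k.+1)%N by lia.
have E : \prod_(j < n + k.+1) (1 - a * b ^+ j) =
    \prod_(j < n) (1 - a * b ^+ j) * \prod_(j < k.+1) (1 - a * b ^+ n * b ^+ j).
  rewrite big_split_ord; congr (_ * _).
  by apply: eq_bigr => i _; rewrite exprD mulrA.
rewrite (eqmod_coef (H a _ a0 nk) (ltnSn k)) E; symmetry.
apply: (eqmod_coef _ (ltnSn k)); apply: eqmodM; first exact: eqmod_refl.
exact: H.
Qed.

Lemma qpoch_eqmod1 K (a b : fps S) : vanish K a -> fcoef b 0 = 0 ->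
  eqmod K (qpoch a b) 1.
Proof.
case: K => [|K] aK b0; first by [].
have a0 : fcoef a 0 = 0 by exact: aK.
move=> i iK; rewrite fcoefB (@qpoch_coef _ _ _ _ i) // -fcoefB.
apply: (@eqmod_prod1 K.+1 i (fun j => 1 - a * b ^+ j)) => // j.
by rewrite /eqmod addrAC subrr add0r; apply/vanishN/vanishMr.
Qed.

End Adic.

(** * Series with nonnegative coefficients *)

Lemma q0 : fcoef q 0 = 0.
Proof. by []. Qed.

Definition nneg (f : fps (laurent int)) := forall k m, 0 <= (fcoef f k)@_m.

Lemma laurent_mul_nneg (a b : laurent int) :
  (forall m, 0 <= a@_m) -> (forall m, 0 <= b@_m) ->
  forall m, 0 <= (a * b : laurent int)@_m.
Proof.
move=> a0 b0 m; rewrite -[a * b]/(laurent_mul a b) /laurent_mul.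
rewrite raddf_sum; apply: sumr_ge0 => i _; rewrite raddf_sum.
apply: sumr_ge0 => j _; rewrite /= mcoeffU; apply: mulrn_wge0.
exact: mulr_ge0.
Qed.

Lemma nnegD (f g : fps (laurent int)) : nneg f -> nneg g -> nneg (f + g).
Proof. by move=> f0 g0 k m; rewrite fcoefD mcoeffD addr_ge0. Qed.

Lemma nneg0 : nneg 0.
Proof. by move=> k m; rewrite [fcoef _ _]/= if_same mcoeff0. Qed.

Lemma nnegM (f g : fps (laurent int)) : nneg f -> nneg g -> nneg (f * g).
Proof.
move=> f0 g0 k m; rewrite fcoefM raddf_sum; apply: sumr_ge0 => i _.
exact: laurent_mul_nneg.
Qed.

Lemma nneg_zpow m : nneg (zpow m).
Proof.
move=> [|k] j; rewrite /zpow /=; last by rewrite mcoeff0.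
by rewrite mcoeffU mulrb; case: ifP.
Qed.

Lemma nneg1 : nneg 1.
Proof. exact: (nneg_zpow 0). Qed.

Lemma nnegq k : nneg (q ^+ k).
Proof.
elim: k => [|k IHk]; first exact: nneg1.
rewrite exprS; apply: nnegM => // i m; rewrite /q /fpsX /=.
case: (i == _); last by rewrite mcoeff0.
by rewrite mcoeffU mulrb; case: ifP.
Qed.

Lemma nneg_sum (I : Type) (r : seq I) (P : pred I)
    (F : I -> fps (laurent int)) :
  (forall i, P i -> nneg (F i)) -> nneg (\sum_(i <- r | P i) F i).
Proof. by apply: (big_ind nneg) => //; [apply: nneg0 | apply: nnegD]. Qed.

Lemma nneg_eqmod (f : fps (laurent int)) :
  (forall K, exists2 h, eqmod K f h & nneg h) -> nneg f.
Proof.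
move=> fg k m; have [h fh h0] := fg k.+1.
by rewrite (eqmod_coef fh).
Qed.

Lemma nneg_geom d : (0 < d)%N -> nneg (1 - q ^+ d)^-1.
Proof.
move=> d0; apply: (@nneg_eqmod _) => K.
exists (\sum_(i < K) (q ^+ d) ^+ i); last first.
  by apply: nneg_sum => i _; rewrite -exprM; apply: nnegq.
have -> : \sum_(i < K) (q ^+ d) ^+ i = (1 - (q ^+ d) ^+ K) / (1 - q ^+ d).
  rewrite -[1 - _ ^+ K]opprB subrX1 -mulNr opprB mulrC mulKr //.
  exact: one_sub_unit.
rewrite /eqmod mulrBl mul1r subKr; apply: vanishMr; rewrite -exprM.
by apply: (vanish_exp q0); rewrite leq_pmull.
Qed.

(** The quotient is a finite geometric sum. *)
Lemma nneg_geom_diff d u t : (0 < d)%N ->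
  nneg ((q ^+ u - q ^+ (u + d * t)) / (1 - q ^+ d)).
Proof.
move=> d0; have -> : (q ^+ u - q ^+ (u + d * t)) / (1 - q ^+ d) =
    \sum_(i < t) q ^+ (u + d * i).
  rewrite exprD exprM -{1}[q ^+ u]mulr1 -mulrBr.
  rewrite -[1 - _ ^+ t]opprB subrX1 -mulNr opprB.
  rewrite -mulrA [X in _ * X]mulrAC divrr ?(one_sub_unit q0) // mul1r mulr_sumr.
  by apply: eq_bigr => i _; rewrite exprD exprM.
by apply: nneg_sum => i _; apply: nnegq.
Qed.

(** * Regrouping the poles *)

Section Blocks.
Variables (R : comUnitRingType) (x : R) (a : nat).
Hypothesis xU : forall k, (0 < k)%N -> 1 - x ^+ k \is a GRing.unit.

(** For odd [j], the contribution of the pole [j] to the coefficient of [z^a],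
    apart from the factor common to all poles. *)
Definition odd_term j := x ^+ (j * (a + (j.+1)./2)) / (1 - x ^+ j).

(** The contribution of the pole [2 k], if [inversion_sum] takes the value
    [(-1)^k x^(k h)] at [2 k]. *)
Definition even_term h k :=
  x ^+ (k.*2 * a) * ((-1) ^+ k * x ^+ (k * h) - x ^+ (k * k.*2.+1)) /
  (1 - x ^+ k.*2).

(** With [b = a + (v + 1) / 2], the sum over the denominator [1 - x^(2 v)] has
    numerator
    [x^(v b) + x^(v (b + 1)) - x^(v (2 a + h)) - x^(v (2 a + 2 v + 1))].
    Of [b] and [b + 1] one is even and one is odd, as are [2 a + h] and
    [2 a + 2 v + 1]; pairing equal parities makes both quotients geometric
    sums. *)
Lemma odd_blockE v h : odd v -> ~~ odd h -> exists e o,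
  [/\ ~~ odd e, odd o, (e <= a + (v.+1)./2 + 1)%N, (o <= a + (v.+1)./2 + 1)%N &
  odd_term v + even_term h v =
  (x ^+ (v * e) - x ^+ (v * (a.*2 + h))) / (1 - x ^+ v.*2) +
  (x ^+ (v * o) - x ^+ (v * (a.*2 + v.*2.+1))) / (1 - x ^+ v.*2)].
Proof.
move=> vo he; set b := (a + (v.+1)./2)%N.
have v0 : (0 < v)%N by case: v vo {b}.
suff H : odd_term v + even_term h v =
  (x ^+ (v * b) + x ^+ (v * b.+1) - x ^+ (v * (a.*2 + h)) -
   x ^+ (v * (a.*2 + v.*2.+1))) / (1 - x ^+ v.*2).
  have [bo|be] := boolP (odd b).
    exists b.+1, b; split; rewrite /= ?bo ?addn1 // H; ring.
  exists b, b.+1; split; rewrite /= ?be ?addn1 // H; ring.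
rewrite /odd_term /even_term -/b -signr_odd vo mulN1r.
have -> : (1 - x ^+ v)^-1 = (1 + x ^+ v) / (1 - x ^+ v.*2).
  have vU := xU v0.
  have E : 1 - x ^+ v.*2 = (1 - x ^+ v) * (1 + x ^+ v).
    by rewrite -addnn exprD; ring.
  have wU : 1 - x ^+ v.*2 \is a GRing.unit by rewrite xU // double_gt0.
  by apply: (mulrI vU); rewrite divrr // mulrA -E divrr.
rewrite (_ : v * b.+1 = v * b + v)%N; last by rewrite mulnS addnC.
rewrite (_ : v * (a.*2 + h) = v.*2 * a + v * h)%N; last by rewrite mulnDr; lia.
rewrite (_ : v * (a.*2 + v.*2.+1) = v.*2 * a + v * v.*2.+1)%N; last first.
  by rewrite mulnDr; lia.
rewrite !exprD; ring.
Qed.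

(** Here [k = 2 (i + 1)] is even and the two exponents differ by [k^2], which is
    [i + 1] times [2 k]. *)
Lemma even_blockE i :
  even_term (3 * i.+1.*2 + 1) i.+1.*2 =
  - \sum_(l < i.+1) x ^+ (i.+1.*2 * (a.*2 + i.+1.*2.*2.+1) + i.+1.*2.*2 * l).
Proof.
set n := i.+1.*2.
have nU : 1 - x ^+ n.*2 \is a GRing.unit by rewrite xU // double_gt0.
apply: (mulIr nU); rewrite /even_term mulrVK // -signr_odd odd_double mul1r.
transitivity (x ^+ (n * (a.*2 + n.*2.+1)) * ((x ^+ n.*2) ^+ i.+1 - 1)).
  rewrite !mulrBr mulr1 -exprM -!exprD.
  by congr (_ ^+ _ - _ ^+ _); rewrite /n; lia.
rewrite subrX1; under [in RHS]eq_bigr do rewrite exprD (exprM x n.*2).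
by rewrite -mulr_sumr; ring.
Qed.

Lemma geom_split d u t s : (0 < d)%N ->
  (x ^+ u - x ^+ (u + d * (t + s))) / (1 - x ^+ d) =
  \sum_(l < t) x ^+ (u + d * l) +
  (x ^+ (u + d * t) - x ^+ (u + d * (t + s))) / (1 - x ^+ d).
Proof.
move=> d0; have dU := xU d0; apply: (mulIr dU); rewrite [RHS]mulrDl !mulrVK //.
under eq_bigr do rewrite exprD (exprM x d).
rewrite -mulr_sumr (exprD x u (d * t)) (exprM x d t).
have := subrX1 (x ^+ d) t; set G := \sum_(_ < _) _ => H.
have -> : (x ^+ d) ^+ t = 1 + (x ^+ d - 1) * G by rewrite -H addrC subrK.
ring.
Qed.

(** For C1: the first [i + 1] monomials of the geometric sum with even exponents
    in the pair of index [2 i + 1] are set against the [i + 1] negative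
    monomials of [even_blockE].  There are enough of them because the exponents
    run from [e] to [2 a + 3 (2 i + 1) + 1] by steps of 2, in units of
    [2 i + 1], with [e <= a + i + 2]; [s] counts those that remain. *)
Lemma rank_blockE i : exists e s o,
  [/\ (e <= a + i + 2)%N, ~~ odd e, ((o <= a + i + 2) && odd o)%N,
    (e + (i.+1 + s).*2 = a.*2 + (3 * i.*2.+1 + 1))%N &
  odd_term i.*2.+1 + even_term (3 * i.*2.+1 + 1) i.*2.+1 +
    even_term (3 * i.+1.*2 + 1) i.+1.*2 =
  (x ^+ (i.*2.+1 * e + i.*2.+1.*2 * i.+1) -
     x ^+ (i.*2.+1 * e + i.*2.+1.*2 * (i.+1 + s))) / (1 - x ^+ i.*2.+1.*2) +
  (x ^+ (i.*2.+1 * o) - x ^+ (i.*2.+1 * (a.*2 + i.*2.+1.*2.+1))) /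
     (1 - x ^+ i.*2.+1.*2) +
  \sum_(l < i.+1) (x ^+ (i.*2.+1 * e + i.*2.+1.*2 * l) -
     x ^+ (i.+1.*2 * (a.*2 + i.+1.*2.*2.+1) + i.+1.*2.*2 * l))].
Proof.
set v := i.*2.+1.
have vo : odd v by rewrite /= odd_double.
have he : ~~ odd (3 * v + 1) by rewrite /v; lia.
have [e [o [ee oo ele ole H]]] := odd_blockE vo he.
have h2 : (v.+1)./2 = i.+1 by rewrite -doubleS doubleK.
rewrite h2 in ele ole.
pose s := ((a.*2 + (3 * v + 1) - e)./2 - i.+1)%N.
have sE : (e + (i.+1 + s).*2 = a.*2 + (3 * v + 1))%N by rewrite /s /v; lia.
exists e, s, o; split=> //; try by lia.
rewrite {}H even_blockE -sE sumrB.
have -> : (v * (e + (i.+1 + s).*2) = v * e + v.*2 * (i.+1 + s))%N by lia.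
rewrite geom_split ?double_gt0 //; ring.
Qed.
End Blocks.

Lemma nneg_geom_diff_dvd d u w : (0 < d)%N -> (u <= w)%N -> (d %| w - u)%N ->
  nneg ((q ^+ u - q ^+ w) / (1 - q ^+ d)).
Proof.
move=> d0 uw /dvdnP[t E]; rewrite -(subnKC uw) E mulnC; exact: nneg_geom_diff.
Qed.

Lemma nneg_block_C5 a i :
  nneg (odd_term q a i.*2.+1 + even_term q a i.*2.+2 i.*2.+1 +
        even_term q a i.+1.*2.+1 i.+1.*2).
Proof.
have vo : odd i.*2.+1 by rewrite /= odd_double.
have he : ~~ odd i.*2.+2 by rewrite /= negbK odd_double.
have [e [o [ee oo ele ole ->]]] := odd_blockE a (one_sub_unit q0) vo he.
have h2 : (i.*2.+2)./2 = i.+1 by rewrite -doubleS doubleK.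
rewrite h2 in ele ole.
apply: nnegD; first apply: nnegD.
- apply: nneg_geom_diff_dvd; rewrite ?double_gt0 //.
    by rewrite leq_mul2l /=; lia.
  rewrite -mulnBr -muln2 dvdn_pmul2l //; lia.
- apply: nneg_geom_diff_dvd; rewrite ?double_gt0 //.
    by rewrite leq_mul2l /=; lia.
  rewrite -mulnBr -muln2 dvdn_pmul2l //; lia.
rewrite /even_term -mulrA; apply: nnegM; first exact: nnegq.
rewrite -signr_odd odd_double mul1r; apply: nneg_geom_diff_dvd => //.
  by rewrite leq_mul2l; apply/orP; right; lia.
by rewrite -mulnBr -muln2 dvdn_pmul2l //; lia.
Qed.

(** The degree of each negative monomial exceeds that of its partner by an even
    number, so that the difference is a multiple of [1 - q^2]. *)
Lemma nneg_block_C1 a i :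
  nneg ((odd_term q a i.*2.+1 + even_term q a (3 * i.*2.+1 + 1) i.*2.+1 +
         even_term q a (3 * i.+1.*2 + 1) i.+1.*2) / (1 - q ^+ 2)).
Proof.
have [e [s [o [ele ee /andP[ole oo] sE ->]]]] :=
  rank_blockE a (one_sub_unit q0) i.
rewrite mulrDl; apply: nnegD; last first.
  rewrite mulr_suml; apply: nneg_sum => l _; apply: nneg_geom_diff_dvd => //.
    apply: leq_add; last by rewrite leq_mul2r; lia.
    by apply: leq_mul; lia.
  rewrite dvdn2 oddB; last first.
    apply: leq_add; last by rewrite leq_mul2r; lia.
    by apply: leq_mul; lia.
  by rewrite !(oddD, oddM, odd_double, oddS) (negPf ee) ?andbF.
apply: nnegM; last exact: nneg_geom.
apply: nnegD; apply: nneg_geom_diff_dvd; rewrite ?double_gt0 //.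
- by rewrite leq_add2l leq_mul2l leq_addr orbT.
- by rewrite subnDl -mulnBr dvdn_mulr.
- by rewrite leq_mul2l; lia.
by rewrite -mulnBr -muln2 dvdn_pmul2l //; lia.
Qed.

(** * Poles and their expansions *)

Section Generic.
Variable R : comUnitRingType.
Implicit Types x y : R.

Definition pole_pair x y j := (1 - y * x ^+ j) * (1 - y^-1 * x ^+ j).

(** The terms in [y + 1/y] cancel; the partial fractions rest on this. *)
Lemma pole_pair_rec x y n d : y \is a GRing.unit ->
  pole_pair x y (n + d) - x ^+ d * pole_pair x y n =
  (1 - x ^+ d) * (1 - x ^+ (n + n + d)).
Proof.
move=> yU; rewrite /pole_pair !exprD.
have := divrr yU; set v := y^-1 => E.
transitivity (1 - x ^+ d + y * v * (x ^+ n * x ^+ d * (x ^+ n * x ^+ d)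
   - x ^+ d * (x ^+ n * x ^+ n))); first by ring.
by rewrite E; ring.
Qed.

(** The coefficient of [x^a] in the sum of [x^|m| y^m] over all integers [m]:
    [y^a + y^-a] for positive [a], and 1 for [a = 0]. *)
Definition laurent_pair y a := y ^+ a + y^-1 ^+ a - (a == 0)%:R.

(** The truncated Poisson kernel, with its explicit error term. *)
Lemma pole_pair_laurent_pair x y j M : y \is a GRing.unit ->
  pole_pair x y j * \sum_(a < M.+1) laurent_pair y a * x ^+ (j * a) =
  1 - (x ^+ j) ^+ 2 - x ^+ (j * M.+1) *
  ((1 - y^-1 * x ^+ j) * y ^+ M.+1 + (1 - y * x ^+ j) * y^-1 ^+ M.+1).
Proof.
move=> yU; set u := y * x ^+ j; set v := y^-1 * x ^+ j.
have uv : u * v = (x ^+ j) ^+ 2 by rewrite /u /v mulrACA divrr // mul1r.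
have -> : \sum_(a < M.+1) laurent_pair y a * x ^+ (j * a) =
    \sum_(a < M.+1) u ^+ a + \sum_(a < M.+1) v ^+ a - 1.
  rewrite -[1 in RHS](_ : \sum_(a < M.+1) (a == 0 :> nat)%:R = 1 :> R);
    last by rewrite big_ord_recl big1 ?addr0.
  rewrite -big_split -sumrB; apply: eq_bigr => a _.
  rewrite /laurent_pair /u /v !exprMn_comm; try exact: mulrC.
  rewrite -exprM; case: (nat_of_ord a) => [|b] /=; last by ring.
  by rewrite muln0 !expr0; ring.
have su := subrX1 u M.+1; have sv := subrX1 v M.+1.
rewrite exprM (_ : x ^+ j ^+ M.+1 * _ =
    (1 - v) * u ^+ M.+1 + (1 - u) * v ^+ M.+1); last first.
  rewrite mulrDr /u /v !exprMn_comm; try exact: mulrC.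
  ring.
rewrite -uv /pole_pair -/u -/v.
transitivity (- (1 - v) * ((u - 1) * \sum_(i < M.+1) u ^+ i) -
 (1 - u) * ((v - 1) * \sum_(i < M.+1) v ^+ i) - (1 - u) * (1 - v)).
  by ring.
by rewrite -su -sv; ring.
Qed.

Lemma crank_rearrange (a b c o f p t : R) :
  o \is a GRing.unit -> f \is a GRing.unit -> p \is a GRing.unit ->
  c \is a GRing.unit -> t \is a GRing.unit ->
  a * b / c = (o * a) * (f * b) * (p * t) / (p * c) * ((o * f)^-1 / t).
Proof.
move=> oU fU pU cU tU; rewrite !invrM //.
transitivity (a * b / c * (o / o) * (f / f) * (p / p) * (t / t)); last by ring.
by rewrite !divrr // !mulr1.
Qed.

Lemma pole_rearrange (Q1 Q2 T c B y D f g : R) : Q2 \is a GRing.unit ->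
  1 - y \is a GRing.unit ->
  Q1 * Q2 * T / c * (B * (1 + y) / D / f / g) =
  T / c * (B / (1 - y) * (Q1 / Q2 * (Q2 / f) * (Q2 / g))) * ((1 - y ^+ 2) / D).
Proof.
move=> QU yU.
transitivity (Q1 * Q2 * T / c * (B * (1 + y) / D / f / g) * (Q2 / Q2) *
  ((1 - y) / (1 - y))); last by ring.
by rewrite !divrr // !mulr1.
Qed.

Definition even_qfact x k := \prod_(i < k) (1 - x ^+ i.+1.*2).

Lemma qfact_double x k : qfact x k.*2 = odd_qfact x k * even_qfact x k.
Proof.
elim: k => [|k IHk].
  by rewrite /odd_qfact /even_qfact qfact0 !big_ord0 mul1r.
have -> : even_qfact x k.+1 = even_qfact x k * (1 - x ^+ k.+1.*2).
  by rewrite /even_qfact big_ord_recr.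
by rewrite odd_qfactS {1}doubleS !qfactS IHk doubleS; ring.
Qed.

Lemma even_qfactV x L : (forall k, (0 < k)%N -> 1 - x ^+ k \is a GRing.unit) ->
  (even_qfact x L.+1)^-1 =
  (1 - x ^+ 2)^-1 * \prod_(i < L) (1 - x ^+ i.+2.*2)^-1.
Proof.
move=> xU; rewrite /even_qfact big_ord_recl invrM; last 2 first.
- exact: xU.
- by apply: rpred_prod => i _; apply: xU.
by rewrite mulrC -prodrV // => i _; apply: xU.
Qed.

End Generic.

Section Sums.
Variable V : nmodType.
Implicit Types F G : nat -> V.

Lemma sum_pairs F P :
  \sum_(1 <= j < P.*2.+1) F j = \sum_(i < P) (F i.*2.+1 + F i.+1.*2).
Proof.
elim: P => [|P IHP]; first by rewrite big_ord0 big_geq.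
by rewrite doubleS big_nat_recr //= big_nat_recr //= IHP big_ord_recr /= addrA.
Qed.

(** Here [F] and [G] stand for the contributions of odd and even poles.  The
    [G]-term of index [k] comes from the pole [2 k]; for odd [k] it is put with
    the [F]-term of the same index, and the [F]-terms of index larger than [2 P]
    are left alone. *)
Lemma sum_blocks F G P :
  \sum_(i < P.*2) (F i.*2.+1 + G i.+1) =
  \sum_(i < P) (F i.*2.+1 + G i.*2.+1 + G i.+1.*2) +
  \sum_(i < P) F (P + i).*2.+1.
Proof.
rewrite big_split /=.
have -> : \sum_(i < P.*2) F i.*2.+1 =
    \sum_(i < P) F i.*2.+1 + \sum_(i < P) F (P + i).*2.+1.
  by rewrite -addnn big_split_ord.
have -> : \sum_(i < P.*2) G i.+1 = \sum_(i < P) (G i.*2.+1 + G i.+1.*2).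
  by rewrite -sum_pairs big_add1 /= big_mkord.
rewrite addrAC -big_split /=; congr (_ + _).
by apply: eq_bigr => i _; rewrite addrA.
Qed.
End Sums.

Section Closed.
Variables (R : comUnitRingType) (x : R) (w e : nat -> nat).
Hypothesis w0 : w 0 = 0%N.
Hypothesis inversion_sum_even :
  forall k, inversion_sum x w k.*2 = (-1) ^+ k * x ^+ (k * e k).
Hypothesis inversion_sum_odd : forall k, inversion_sum x w k.*2.+1 = 0.

Lemma inversion_term0 j : inversion_term x w j 0 = (-1) ^+ j * x ^+ 'C(j.+1, 2).
Proof.
rewrite /inversion_term symprod0 w0 !addn0 subn0 mulr1 /beta /qfact /odd_qfact.
by rewrite !big_ord0 mulr1 invr1 mulr1.
Qed.

(** The division by [1 - x^j] turns the [1 + x^j] of the partial fractions into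
    the numerator [1 - x^(2 j)] of the Poisson kernel. *)
Definition pole_coef j :=
  (inversion_sum x w j - inversion_term x w j 0) / (1 - x ^+ j).

Lemma pole_coef_odd a k :
  pole_coef k.*2.+1 * x ^+ (k.*2.+1 * a) = odd_term x a k.*2.+1.
Proof.
rewrite /pole_coef inversion_sum_odd inversion_term0 /odd_term -signr_odd /=.
rewrite odd_double expr1 mulN1r opprK add0r.
rewrite mulrAC -exprD; congr (x ^+ _ / _).
rewrite -doubleS doubleK bin2 -doubleMl doubleK doubleS /=; lia.
Qed.

Lemma pole_coef_even a k :
  pole_coef k.*2 * x ^+ (k.*2 * a) = even_term x a (e k) k.
Proof.
rewrite /pole_coef inversion_sum_even inversion_term0 /even_term.
rewrite -(signr_odd _ k.*2) odd_double mul1r.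
rewrite mulrAC [X in X / _]mulrC; congr (_ * (_ - x ^+ _) / _).
by rewrite bin2 /= mulnC -doubleMl doubleK.
Qed.

Lemma pole_coef_sum a P :
  \sum_(1 <= j < P.*2.*2.+1) pole_coef j * x ^+ (j * a) =
  \sum_(i < P) (odd_term x a i.*2.+1 + even_term x a (e i.*2.+1) i.*2.+1 +
     even_term x a (e i.+1.*2) i.+1.*2) +
  \sum_(i < P) odd_term x a (P + i).*2.+1.
Proof.
rewrite sum_pairs -(sum_blocks _ (fun k => even_term x a (e k) k)).
by apply: eq_bigr => i _; rewrite pole_coef_odd pole_coef_even.
Qed.
End Closed.

(** * The generating function modulo a power of q *)

Section Split.
Variables (S : comNzRingType) (x y : fps S).
Hypothesis x0 : fcoef x 0 = 0.

Lemma qpoch_odd_qfact n :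
  qpoch x (x ^+ 2) = odd_qfact x n * qpoch (x ^+ n.*2.+1) (x ^+ 2).
Proof.
rewrite (@qpoch_split _ _ _ n) //; last by rewrite fcoefM0 x0 mul0r.
rewrite -exprM -exprS mul2n; congr (_ * _).
by apply: eq_bigr => i _; rewrite -exprM -exprS mul2n.
Qed.

Lemma qpoch_qfact n : qpoch x x = qfact x n * qpoch (x ^+ n.+1) x.
Proof.
rewrite (@qpoch_split _ _ _ n) // -exprS; congr (_ * _).
by apply: eq_bigr => i _; rewrite -exprS.
Qed.

Lemma qpoch_linear n : (0 < n)%N ->
  qpoch (y * x) x = \prod_(1 <= i < n) (1 - y * x ^+ i) * qpoch (y * x ^+ n) x.
Proof.
case: n => // n _; rewrite (@qpoch_split _ _ _ n) //; last first.
  by rewrite fcoefM0 x0 mulr0.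
rewrite -mulrA -exprS big_add1 big_mkord; congr (_ * _).
by apply: eq_bigr => i _; rewrite -mulrA -exprS.
Qed.
End Split.

Section Assembly.
Variables (S : comNzRingType) (x y : fps S).
Hypothesis x0 : fcoef x 0 = 0.
Hypothesis yU : y \is a GRing.unit.

Definition denominator n := qpoch (y * x ^+ n) x * qpoch (y^-1 * x ^+ n) x.

Lemma denominator_unit n : (0 < n)%N -> denominator n \is a GRing.unit.
Proof.
move=> n0; rewrite unitrM; apply/andP.
by split; apply: qpoch_unit; rewrite ?fcoefM0 ?(fcoefX_lt x0) ?mulr0.
Qed.

(** [crank_factor] for arbitrary series in place of [q] and [z]. *)
Definition crank_term n :=
  qpoch (x ^+ n.*2.+1) (x ^+ 2) * qpoch (x ^+ n.+1) x
    / denominator n.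

Lemma pole_pair_unit j : pole_pair x y j.+1 \is a GRing.unit.
Proof.
have qj : fcoef (x ^+ j.+1) 0 = 0 by apply: (vanish_exp x0 (leqnn _)).
rewrite unitrM; apply/andP; split; apply: fps_unit_coef0;
  by rewrite fcoefB fcoefM0 qj mulr0 subr0 fcoef1.
Qed.

Lemma pole_pair_prod_unit a b : (0 < a)%N ->
  \prod_(a <= i < b) pole_pair x y i \is a GRing.unit.
Proof.
move=> a0; rewrite big_nat; apply: rpred_prod => -[|i] /andP[ai _].
  by move: a0; rewrite ltnNge ai.
exact: pole_pair_unit.
Qed.

Definition prefactor M :=
  qpoch x (x ^+ 2) * qpoch x x * \prod_(1 <= i < M.+1) pole_pair x y i
    / denominator 1.

Lemma qpoch_pole_pair n : (0 < n)%N ->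
  denominator 1 = \prod_(1 <= i < n) pole_pair x y i * denominator n.
Proof.
move=> n0; rewrite /denominator expr1 (qpoch_linear y x0 n0).
by rewrite (qpoch_linear y^-1 x0 n0) mulrACA -big_split.
Qed.

(** The infinite products are cut at [n] in the numerator and at [M] in the
    denominator, and the rest does not depend on [n]. *)
Lemma crank_term_finite M n : (0 < n)%N -> (n <= M)%N ->
  crank_term n =
  prefactor M * (beta x n / \prod_(n <= i < M.+1) pole_pair x y i).
Proof.
move=> n0 nM; rewrite /prefactor (qpoch_pole_pair n0).
rewrite (qpoch_odd_qfact x0 n) (qpoch_qfact x0 n).
rewrite (big_cat_nat _ (n := n) (p := M.+1)) //; last exact: leqW.
rewrite /crank_term /beta; apply: crank_rearrange.
- exact: odd_qfact_unit (one_sub_unit x0) _.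
- exact: qfact_unit (one_sub_unit x0) _.
- exact: pole_pair_prod_unit.
- exact: denominator_unit.
exact: pole_pair_prod_unit.
Qed.

Lemma qfact_tail K k : (K <= k.+1)%N -> eqmod K (qpoch x x / qfact x k) 1.
Proof.
move=> Kk; rewrite (qpoch_qfact x0 k) mulrAC divrr ?mul1r; last first.
  exact: qfact_unit (one_sub_unit x0) _.
by apply: qpoch_eqmod1 => //; apply: (vanish_exp x0).
Qed.

Lemma even_qfact_unit k : even_qfact x k \is a GRing.unit.
Proof.
by apply: rpred_prod => i _; apply: (one_sub_unit x0); rewrite double_gt0.
Qed.

(** Euler's [(x)_oo = (x;x^2)_oo (x^2;x^2)_oo]. *)
Lemma euler_quotient K L : (K <= L)%N ->
  eqmod K (qpoch x (x ^+ 2) / qpoch x x) (even_qfact x L)^-1.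
Proof.
move=> KL.
have oU := odd_qfact_unit (one_sub_unit x0) L; have eU := even_qfact_unit L.
have -> : (even_qfact x L)^-1 = odd_qfact x L / qfact x L.*2.
  by rewrite qfact_double invrM // mulrCA divrr ?mulr1.
have q2 : fcoef (x ^+ 2) 0 = 0 by apply: (vanish_exp x0 (leqnn _)).
apply: eqmodM.
  rewrite (qpoch_odd_qfact x0 L) -{2}[odd_qfact x L]mulr1.
  apply: eqmodM; first exact: eqmod_refl.
  by apply: qpoch_eqmod1 => //; apply: (vanish_exp x0); lia.
apply: eqmodV; [exact: qpoch_unit| exact: qfact_unit (one_sub_unit x0) _ |].
rewrite (qpoch_qfact x0 L.*2) -{2}[qfact x L.*2]mulr1.
apply: eqmodM; first exact: eqmod_refl.
by apply: qpoch_eqmod1 => //; apply: (vanish_exp x0); lia.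
Qed.

Lemma pole_pair_tail M :
  eqmod M.+1 (\prod_(1 <= i < M.+1) pole_pair x y i / denominator 1) 1.
Proof.
have cU := denominator_unit (ltn0Sn M).
rewrite (qpoch_pole_pair (ltn0Sn M)) invrM ?pole_pair_prod_unit //.
rewrite mulrCA divrr ?pole_pair_prod_unit // mulr1 -[X in eqmod _ _ X]invr1.
apply: eqmodV; [exact: cU | exact: unitr1 |].
rewrite -[X in eqmod _ _ X]mulr1.
by apply: eqmodM; apply: qpoch_eqmod1 => //; apply/vanishMl/(vanish_exp x0).
Qed.

Lemma poisson_expansion M j : (0 < j)%N ->
  eqmod M.+1 ((1 - (x ^+ j) ^+ 2) / pole_pair x y j)
             (\sum_(a < M.+1) laurent_pair y a * x ^+ (j * a)).
Proof.
case: j => // j _; have DU := pole_pair_unit j.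
have := pole_pair_laurent_pair x j.+1 M yU; set G := \sum_(_ < _) _.
set T := (1 - y^-1 * _) * _ + _ => H.
have E : 1 - (x ^+ j.+1) ^+ 2 =
    pole_pair x y j.+1 * G + x ^+ (j.+1 * M.+1) * T.
  by rewrite H subrK.
rewrite /eqmod E mulrDl mulrAC divrr // mul1r addrAC subrr add0r.
by do 2![apply: vanishMr]; apply: (vanish_exp x0); rewrite leq_pmull.
Qed.

(** The factor [qfact x (M - j)] agrees with its limit only modulo
    [x^(M - j + 1)]; the missing factor [x^j] is provided by
    [pole_coef x w j]. *)
Lemma generating_eqmod w M :
  (forall j, (0 < j)%N -> vanish j (pole_coef x w j)) ->
  eqmod M.+1 (\sum_(1 <= n < M.+1) x ^+ w n * crank_term n)
    (\sum_(a < M.+1) laurent_pair y a *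
      ((even_qfact x M.+1)^-1 *
       \sum_(1 <= j < M.+1) pole_coef x w j * x ^+ (j * a))).
Proof.
move=> bv.
have -> : \sum_(1 <= n < M.+1) x ^+ w n * crank_term n = prefactor M *
    \sum_(1 <= n < M.+1)
      x ^+ w n * beta x n / \prod_(n <= i < M.+1) pole_pair x y i.
  rewrite mulr_sumr big_nat [RHS]big_nat; apply: eq_bigr => n /andP[n0 nM].
  by rewrite (crank_term_finite n0 nM) mulrCA -mulrA.
rewrite (finite_bailey (one_sub_unit x0) pole_pair_unit
  (fun n d => pole_pair_rec x n d yU)).
have -> : \sum_(a < M.+1) laurent_pair y a * ((even_qfact x M.+1)^-1 *
      \sum_(1 <= j < M.+1) pole_coef x w j * x ^+ (j * a)) =
    \sum_(1 <= j < M.+1) 1 * (pole_coef x w j / even_qfact x M.+1) *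
      \sum_(a < M.+1) laurent_pair y a * x ^+ (j * a).
  under eq_bigr do rewrite !mulr_sumr.
  rewrite exchange_big /=; apply: eq_bigr => j _.
  by rewrite mulr_sumr; apply: eq_bigr => a _; ring.
rewrite mulr_sumr big_nat [X in eqmod _ _ X]big_nat.
apply: eqmod_sum => j /andP[j0 jM].
have QU : qpoch x x \is a GRing.unit by exact: qpoch_unit.
rewrite /prefactor (pole_rearrange _ _ _ _ _ _ _ QU (one_sub_unit x0 j0)).
apply: eqmodM; last exact: poisson_expansion.
apply: eqmodM; first exact: pole_pair_tail.
rewrite -(subnKC (ltnW jM)); apply: eqmod_shift; first exact: bv.
rewrite -[X in eqmod _ _ X]mulr1 -[X in eqmod _ _ (X * 1)]mulr1.
rewrite subnKC; last exact: ltnW.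
apply: eqmodM; first apply: eqmodM.
- by apply: euler_quotient; lia.
- by apply: qfact_tail; lia.
by apply: qfact_tail; lia.
Qed.

End Assembly.

Lemma zU : z \is a GRing.unit.
Proof.
apply/unitrPr; exists (zpow (-1)); apply: fpsP => -[|n].
  by rewrite fcoefM0 [LHS]laurent_mulUU.
rewrite fcoefM big1 // => -[[|i] ?] _; rewrite /=.
  by rewrite mulr0.
by rewrite mul0r.
Qed.

Lemma nneg_laurent_pair a : nneg (laurent_pair z a).
Proof.
have nX f k : nneg f -> nneg (f ^+ k).
  move=> f0; elim: k => [|k IHk]; first exact: nneg1.
  by rewrite exprS; apply: nnegM.
case: a => [|a]; rewrite /laurent_pair /=.
  by rewrite !expr0 addrK; apply: nneg1.
rewrite subr0; apply: nnegD; apply: nX; first exact: nneg_zpow.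
by rewrite zV; apply: nneg_zpow.
Qed.

Lemma vanish_pole_coef (w e : nat -> nat) : w 0 = 0%N ->
  (forall k, inversion_sum q w k.*2 = (-1) ^+ k * q ^+ (k * e k)) ->
  (forall k, inversion_sum q w k.*2.+1 = 0) ->
  (forall k, (0 < k)%N -> (1 < e k)%N) ->
  forall j, (0 < j)%N -> vanish j (pole_coef q w j).
Proof.
move=> w0 bE bO e2 j j0; apply: vanishMr; apply: vanishD; last first.
  rewrite inversion_term0 //; apply/vanishN/vanishMl/(vanish_exp q0).
  by rewrite binS bin1 leq_addl.
rewrite -(odd_double_half j) in j0 *; case: (odd j) j0 => j0.
  by rewrite add1n bO => i _; rewrite /= if_same.
rewrite add0n bE; apply/vanishMl/(vanish_exp q0).
rewrite -muln2 leq_mul2l e2 ?orbT //; move: j0; rewrite add0n.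
by case: (j./2).
Qed.

Lemma even_qfactV_split L : exists2 g, nneg g &
  (even_qfact q L.+1)^-1 = (1 - q ^+ 2)^-1 * g.
Proof.
exists (\prod_(i < L) (1 - q ^+ i.+2.*2)^-1).
  apply: (big_ind nneg); [exact: nneg1 | exact: nnegM |].
  by move=> i _; apply: nneg_geom.
exact: even_qfactV (one_sub_unit q0).
Qed.

(** * Nonnegativity *)

Lemma generating_nneg (w e : nat -> nat) P :
  w 0 = 0%N ->
  (forall k, inversion_sum q w k.*2 = (-1) ^+ k * q ^+ (k * e k)) ->
  (forall k, inversion_sum q w k.*2.+1 = 0) ->
  (forall k, (0 < k)%N -> (1 < e k)%N) ->
  (forall a i, nneg ((odd_term q a i.*2.+1 + even_term q a (e i.*2.+1) i.*2.+1 +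
     even_term q a (e i.+1.*2) i.+1.*2) / (1 - q ^+ 2))) ->
  forall n m, (n <= P)%N ->
  0 <= (fcoef (\sum_(1 <= k < P.*2.*2.+1) q ^+ w k * crank_factor k) n)@_m.
Proof.
move=> w0 bE bO e2 block n m nP.
have nq : (n < P.*2.*2.+1)%N by lia.
have E := @generating_eqmod _ q z q0 zU w P.*2.*2
  (vanish_pole_coef w0 bE bO e2).
under eq_bigr do rewrite -/(crank_term q z _).
rewrite (eqmod_coef E nq).
move: n m {nP nq E}; change (nneg (\sum_(a < P.*2.*2.+1) laurent_pair z a *
   ((even_qfact q P.*2.*2.+1)^-1 *
    \sum_(1 <= j < P.*2.*2.+1) pole_coef q w j * q ^+ (j * a)))).
apply: nneg_sum => a _; apply: nnegM; first exact: nneg_laurent_pair.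
rewrite (pole_coef_sum w0 bE bO) mulrDr.
have [g g0 ->] := even_qfactV_split P.*2.*2.
apply: nnegD; last first.
  apply: nnegM; first by apply: nnegM => //; apply: nneg_geom.
  by apply: nneg_sum => i _; apply: nnegM; [apply: nnegq | apply: nneg_geom].
rewrite mulrAC; apply: nnegM => //; rewrite mulrC mulr_suml.
by apply: nneg_sum => i _.
Qed.

Theorem theorem1p4 (m : int) (n : nat) (hn : (0 < n)%N) :
  (0 <= M_C1 m n)%R /\ (0 <= M_C5 m n)%R.
Proof.
have nn : (n <= n.*2.*2)%N by lia.
rewrite (M_C1E m nn) (M_C5E m nn); split.
  apply: (@generating_nneg id (fun k => 3 * k + 1)%N n) => //.
  - by move=> k; case: (inversion_sum_id (one_sub_unit q0) k).
  - by move=> k; case: (inversion_sum_id (one_sub_unit q0) k).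
  - by move=> k; lia.
  - exact: nneg_block_C1.
have -> : \sum_(1 <= k < n.*2.*2.+1) q ^+ ((k ^ 2 + k) %/ 2) * crank_factor k =
    \sum_(1 <= k < n.*2.*2.+1) q ^+ 'C(k.+1, 2) * crank_factor k.
  apply: eq_bigr => k _; congr (_ ^+ _ * _).
  by rewrite bin2 divn2 /= mulSn addnC.
apply: (@generating_nneg (fun k => 'C(k.+1, 2)) (fun k => k + 1)%N n) => //.
- by move=> k; case: (inversion_sum_triangular (one_sub_unit q0) k).
- by move=> k; case: (inversion_sum_triangular (one_sub_unit q0) k).
- by move=> k; lia.
move=> a i; rewrite !addn1; apply: nnegM; first exact: nneg_block_C5.
exact: nneg_geom.
Qed.
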